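(* Let $\lambda\in(0,1)$. Then $E_\lambda$ is totally self-similar if and only if $\lambda=1-3^{-m}$ for some positive integer $m$.
   Context: For $\lambda\in(0,1)$ let $\Omega_\lambda=\{0,\lambda,2\}$ and $f_d(x)=\frac{x+d}{3}$ for $d\in\Omega_\lambda$, $x\in\mathbb{R}$. $E_\lambda$ is the unique non-empty compact subset of $\mathbb{R}$ with $E_\lambda=\bigcup_{d\in\Omega_\lambda}f_d(E_\lambda)$. Its convex hull is $I=[0,1]$. $\Omega_\lambda^*=\bigcup_{n\ge 0}\Omega_\lambda^n$ is the set of all finite words over $\Omega_\lambda$, including the empty word $\epsilon$. For $\mathbf{i}=d_1\ldots d_n\in\Omega_\lambda^n$ put $f_{\mathbf{i}}=f_{d_1}\circ\cdots\circ f_{d_n}$, and $f_\epsilon$ is the identity map. The set $E_\lambda$ is called totally self-similar if $f_{\mathbf{i}}(E_\lambda)=f_{\mathbf{i}}(I)\cap E_\lambda$ for every $\mathbf{i}\in\Omega_\lambda^*$. *)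

(* Defs.v *)
From HB Require Import structures.
From mathcomp Require Import all_boot all_order all_algebra.
From mathcomp Require Import all_classical all_reals all_analysis.
Import Order.TTheory GRing.Theory Num.Theory.
Import numFieldNormedType.Exports.
Set Implicit Arguments.
Unset Strict Implicit.
Unset Printing Implicit Defensive.
Local Open Scope classical_set_scope.
Local Open Scope ring_scope.

Definition Omega (R : realType) (lambda : R) : set R := [set 0; lambda; 2].

Definition fmapd (R : realType) (d x : R) : R := (x + d) / 3.

(* For a given lambda, exactly one set satisfies this predicate (Hutchinson);
   it is the set written E_lambda. *)
Definition is_attractor (R : realType) (lambda : R) (E : set R) : Prop :=
  [/\ E !=set0, compact E & E = \bigcup_(d in Omega lambda) (fmapd d @` E)].

Definition words (R : realType) (lambda : R) : set (seq R) :=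
  [set w | forall d, d \in w -> Omega lambda d].

Definition fword (R : realType) (w : seq R) : R -> R :=
  foldr (fun d g => fmapd d \o g) id w.

(* The interval [0, 1] is the convex hull of E_lambda. *)
Definition totally_self_similar (R : realType) (lambda : R) (E : set R) : Prop :=
  forall w : seq R, words lambda w ->
    fword w @` E = (fword w @` `[0, 1]) `&` E.

(* Main.v *)
(* If E is totally self-similar, write 1 - lambda = 3^-k u with 1/3 < u <= 1.
   The overlap of f_0(I) and f_lambda(I), blown up by 3^k, shows that
   translation by 1 - u carries the complement of E in [1 - u, 1] back into the
   complement of E in [0, u].  The gap ](1 + lambda)/3, 2/3[ lies in
   [1 - u, 1], and it is the only gap of E of length at least (1 - lambda)/3;
   hence 1 - u = 0.
   Conversely, let lambda = 1 - 3^-m.  The only non-obvious point is that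
   x in E with x <= 1/3 implies 3x in E.  If x = f_lambda(e), then
   e = f_0^(m-1)(e') with e' in E, e' <= 1/3, and 3x = f_2^m(3e').  Thus the
   distance from 3x to E is at most 3^-m times that from 3e' to E, and
   iterating shows that it vanishes. *)
Require Import Defs.
From HB Require Import structures.
From mathcomp Require Import all_boot all_order all_algebra.
From mathcomp Require Import all_classical all_reals all_analysis.
From mathcomp Require Import lra.
Import Order.TTheory GRing.Theory Num.Theory.
Import numFieldNormedType.Exports.
Set Implicit Arguments.
Unset Strict Implicit.
Unset Printing Implicit Defensive.
Local Open Scope classical_set_scope.
Local Open Scope ring_scope.

(** * Negative powers of 3 and limits along them *)

Lemma pow3VS (R : realType) (n : nat) : 3 ^- n.+1 = 3 ^- n / 3 :> R.
Proof. by rewrite exprS invfM mulrC. Qed.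

Lemma pow3V_gt0 (R : realType) (n : nat) : 0 < 3 ^- n :> R.
Proof. by rewrite invr_gt0 exprn_gt0. Qed.

Lemma pow3V_le1 (R : realType) (n : nat) : 3 ^- n <= 1 :> R.
Proof. by rewrite invf_le1 ?exprn_gt0// exprn_ege1// ler1n. Qed.

Lemma pow3V_lt (R : realType) (e : R) : 0 < e -> exists n, 3 ^- n < e.
Proof.
move=> e0; exists (Num.bound e^-1).
rewrite invf_plt ?posrE ?exprn_gt0//.
have ei0 : 0 <= e^-1 by rewrite invr_ge0 ltW.
apply: (lt_trans (archi_boundP ei0)).
by rewrite -natrX ltr_nat ltn_expl.
Qed.

Lemma pow3V_bracket (R : realType) (t : R) : 0 < t <= 1 ->
  exists k, 3 ^- k.+1 < t <= 3 ^- k.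
Proof.
move=> /andP[t0 t1].
have ex : exists n, 3 ^- n < t by exact: pow3V_lt.
(* The least n with 3^-n < t is positive because t <= 1; k is its predecessor. *)
case: (ex_minnP ex) => -[|k] kt kmin.
  by move: kt; rewrite expr0 invr1 ltNge t1.
exists k; rewrite kt leNgt /=; apply/negP => /kmin.
by rewrite ltnn.
Qed.

Lemma closed_pow3V (R : realType) (E : set R) (x : R) : closed E ->
  (forall n, exists2 y, E y & `|x - y| <= 3 ^- n) -> E x.
Proof.
move=> cE xE; apply: cE => B /nbhs_ballP[e /= e0 eB].
have [n ne] := pow3V_lt e0.
have [y Ey xy] := xE n.
by exists y; split => //; apply: eB; apply: le_lt_trans ne.
Qed.

Section fword_facts.
Context (R : realType).
Implicit Types (x d lambda : R) (w : seq R) (E : set R).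

Lemma fmapd_inj d : injective (fmapd d).
Proof. by rewrite /fmapd => x y ?; lra. Qed.

Lemma fword_inj w : injective (fword w).
Proof.
elim: w => [|d w ih] x y //= /fmapd_inj; exact: ih.
Qed.

Lemma fword_nseq0 k x : fword (nseq k 0) x = 3 ^- k * x.
Proof.
elim: k => [|k ih]; first by rewrite /= expr0 invr1 mul1r.
by rewrite /= ih pow3VS /fmapd; lra.
Qed.

Lemma fword_nseq2 k x : fword (nseq k 2) x = 1 - 3 ^- k + 3 ^- k * x.
Proof.
elim: k => [|k ih]; first by rewrite /= expr0 invr1 mul1r subrr add0r.
by rewrite /= ih pow3VS /fmapd; lra.
Qed.

Lemma Omega0 lambda : Omega lambda 0. Proof. by left; left. Qed.
Lemma Omegal lambda : Omega lambda lambda. Proof. by left; right. Qed.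
Lemma Omega2 lambda : Omega lambda 2. Proof. by right. Qed.

Lemma OmegaP lambda d : Omega lambda d -> [\/ d = 0, d = lambda | d = 2].
Proof. by move=> [[|]|] ->; [constructor 1|constructor 2|constructor 3]. Qed.

Lemma words_cons lambda d w :
  words lambda (d :: w) <-> Omega lambda d /\ words lambda w.
Proof.
split=> [W|[Od W] c]; last by rewrite in_cons => /orP[/eqP ->//|/W].
by split=> [|c cw]; apply: W; rewrite in_cons ?eqxx ?cw ?orbT.
Qed.

Lemma words_nseq lambda k d : Omega lambda d -> words lambda (nseq k d).
Proof. by move=> Od c /nseqP[-> _]. Qed.

End fword_facts.

(** * Hull, endpoints and gaps of the attractor *)

Section attractor.
Context (R : realType) (lambda : R) (E : set R).
Hypotheses (hlambda : 0 < lambda < 1) (hE : is_attractor lambda E).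

Lemma attractor_fmapd d x : Omega lambda d -> E x -> E (fmapd d x).
Proof.
move=> Od Ex; case: hE => _ _ ->.
by exists d => //; exists x.
Qed.

Lemma attractor_fword w x : words lambda w -> E x -> E (fword w x).
Proof.
elim: w => [|d w ih] //= /words_cons[Od W] Ex.
by apply: attractor_fmapd => //; apply: ih.
Qed.

Lemma attractor_preim x : E x ->
  exists2 y, E y & [\/ x = fmapd 0 y, x = fmapd lambda y | x = fmapd 2 y].
Proof.
case: hE => _ _ eE; rewrite {1}eE => -[d /OmegaP Od [y Ey <-]].
exists y => //.
by case: Od => ->; [constructor 1|constructor 2|constructor 3].
Qed.

Lemma attractor_closed : closed E.
Proof.
by case: hE => _ cE _; apply: compact_closed => //; exact: Rhausdorff.
Qed.

Lemma attractor_bound x : E x -> 0 <= x <= 1.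
Proof.
have [l0 l1] := andP hlambda.
case: hE => E0 cE _ Ex.
have [M [_ MB]] := compact_bounded cE.
have {}MB y : E y -> `|y| <= M + 1 by move=> Ey; apply: (MB (M + 1)) => //; rewrite ltrDl.
have hu : has_ubound E by exists (M + 1) => y /MB; rewrite ler_norml => /andP[].
have hl : has_lbound E.
  by exists (- (M + 1)) => y /MB; rewrite ler_norml => /andP[].
have uE := ub_le_sup hu.
have lE := ge_inf hl.
(* The self-similarity equation at the two extremes forces [sup E <= 1] and, below, [0 <= inf E]. *)
have supE : sup E <= (sup E + 2) / 3.
  apply: ge_sup => // y /attractor_preim[z /uE zE].
  by rewrite /fmapd => -[] ->; lra.
have infE : inf E / 3 <= inf E.
  apply: lb_le_inf => // y /attractor_preim[z /lE zE].
  by rewrite /fmapd => -[] ->; lra.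
by have := uE _ Ex; have := lE _ Ex; lra.
Qed.

Lemma attractor0 : E 0.
Proof.
case: hE => -[e Ee] _ _.
apply: (closed_pow3V attractor_closed) => n.
exists (fword (nseq n 0) e).
  by apply: attractor_fword Ee; apply: words_nseq; exact: Omega0.
have /andP[e0 e1] := attractor_bound Ee; have n0 := pow3V_gt0 R n.
rewrite fword_nseq0 sub0r normrN ger0_norm ?mulr_ge0//.
by rewrite ler_piMr// ltW.
Qed.

Lemma attractor1 : E 1.
Proof.
apply: (closed_pow3V attractor_closed) => n.
exists (fword (nseq n 2) 0).
  by apply: attractor_fword attractor0; apply: words_nseq; exact: Omega2.
by rewrite fword_nseq2 mulr0 addr0 subKr ger0_norm//.
Qed.

(** The points lambda/3, 1/3, (1+lambda)/3, 2/3 of E cut I, so ]a, b[ lies in some f_d(I) or in the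
    central gap ](1+lambda)/3, 2/3[. In the latter case its length makes it the whole gap. The
    former is impossible: pulled back by f_d it is three times as long, hence by induction it is the
    central gap, and b - a = (1-lambda)/9 is too short. The bound [3 ^- n < b - a] is the induction
    measure. *)
Lemma attractor_gap n a b : 0 <= a -> b <= 1 ->
  (forall x, a < x < b -> ~ E x) ->
  (1 - lambda) / 3 <= b - a -> 3 ^- n < b - a ->
  a = (1 + lambda) / 3 /\ b = 2 / 3.
Proof.
have [l0 l1] := andP hlambda.
have [E0 E1] := (attractor0, attractor1).
elim: n a b => [|n ih] a b a0 b1 abE lab nab.
  by exfalso; move: nab; rewrite expr0 invr1; lra.
have scale d : Omega lambda d -> d / 3 <= a -> b <= (1 + d) / 3 -> False.
  move=> Od da bd.
  have [|||||aE bE] := ih (3 * a - d) (3 * b - d); try lra.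
    move=> x xab Ex; apply: (abE (fmapd d x)); first by rewrite /fmapd; lra.
    exact: attractor_fmapd.
  by move: nab; rewrite pow3VS; lra.
have out x : E x -> x <= a \/ b <= x.
  move=> Ex; have [|xa] := leP x a; first by left.
  by right; rewrite leNgt; apply/negP => xb; apply: (abE x) => //; rewrite xa.
have O0 := Omega0 lambda; have Ol := Omegal lambda; have O2 := Omega2 lambda.
move: (scale _ O0) (scale _ Ol) (scale _ O2).
have := out _ (attractor_fmapd Ol E0); have := out _ (attractor_fmapd O0 E1).
have := out _ (attractor_fmapd Ol E1); have := out _ (attractor_fmapd O2 E0).
rewrite /fmapd => -[p1|p1] [p2|p2] [p3|p3] [p4|p4] s0 sl s2;
  solve [lra | case: s0; lra | case: sl; lra | case: s2; lra].
Qed.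

(** * Total self-similarity forces the form of lambda *)

Lemma tss_fword w x : totally_self_similar lambda E -> words lambda w ->
  0 <= x <= 1 -> E (fword w x) -> E x.
Proof.
move=> T W x01 Ex.
have : (fword w @` `[0, 1] `&` E) (fword w x).
  by split => //; exists x => //=; rewrite in_itv.
by rewrite -(T w W) => -[y Ey /fword_inj <-].
Qed.

Lemma tss_lambda : totally_self_similar lambda E ->
  exists m : nat, (0 < m)%N /\ lambda = 1 - 3 ^- m.
Proof.
move=> T; have [l0 l1] := andP hlambda.
have [k /andP[kt tk]] : exists k, 3 ^- k.+1 < 1 - lambda <= 3 ^- k.
  by apply: pow3V_bracket; lra.
have p0 := pow3V_gt0 R k.
pose u : R := 3 ^+ k * (1 - lambda).
have uE : 3 ^- k * u = 1 - lambda by rewrite /u mulKf// gt_eqF ?exprn_gt0.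
have u1 : u <= 1 by rewrite -(ler_pM2l p0) uE mulr1.
have u3 : 1 / 3 < u by rewrite -(ltr_pM2l p0) uE; move: kt; rewrite pow3VS; lra.
have shift y : 0 <= y <= u -> E y -> E (y + (1 - u)).
  move=> y0u Ey.
  have Wk2 : words lambda (nseq k 2) by apply: words_nseq; exact: Omega2.
  have Wk0 : words lambda (nseq k 0) by apply: words_nseq; exact: Omega0.
  (* The point f_2^k(y + 1 - u) equals 3^-k y + lambda, and f_0 sends it to f_lambda(f_0^k(y)),
     which is in E; total self-similarity cancels f_0 and then f_2^k. *)
  apply: (tss_fword T Wk2); first lra.
  rewrite fword_nseq2.
  have -> : 1 - 3 ^- k + 3 ^- k * (y + (1 - u)) = 3 ^- k * y + lambda.
    by move: uE; lra.
  have W0 : words lambda [:: 0] by apply: (@words_nseq _ _ 1 0); exact: Omega0.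
  have ky0 : 0 <= 3 ^- k * y by rewrite mulr_ge0 ?(ltW p0)//; lra.
  have kyu : 3 ^- k * y <= 3 ^- k * u by rewrite ler_pM2l//; lra.
  apply: (tss_fword T W0); first by move: ky0 kyu; rewrite uE; lra.
  have := attractor_fmapd (Omegal lambda) (attractor_fword Wk0 Ey).
  by rewrite /= fword_nseq0 /fmapd addr0.
have Es : E (1 - u) by have := shift 0 _ attractor0; rewrite add0r; apply; lra.
(* As u > 1/3, the point 1 - u of E lies below 2/3, hence to the left of the central gap. *)
have sG : 1 - u <= (1 + lambda) / 3.
  case/attractor_preim: Es => y /attractor_bound y01.
  by rewrite /fmapd => -[]; lra.
have gapE x : (1 + lambda) / 3 < x < 2 / 3 -> ~ E x.
  move=> xG /attractor_preim[y /attractor_bound y01].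
  by rewrite /fmapd => -[]; lra.
have [n nl] : exists n, 3 ^- n < (1 - lambda) / 3 by apply: pow3V_lt; lra.
(* The central gap moved left by 1 - u is again free of E, so it is the central gap itself and u =
   1. *)
have [|||||aE _] :=
  @attractor_gap n ((1 + lambda) / 3 - (1 - u)) (2 / 3 - (1 - u)); try lra.
  move=> x xG Ex; apply: (gapE (x + (1 - u))); first lra.
  by apply: shift => //; lra.
have uE1 : u = 1 by lra.
move: uE; rewrite uE1 mulr1 => kE.
(* The value k = 0 would give lambda = 0. *)
exists k; split; last lra.
by case: k {kt tk p0 u u1 u3 shift Es sG aE uE1} kE => //;
   rewrite expr0 invr1; lra.
Qed.

(** * The converse: cancelling one map at a time *)

Lemma attractor_top k x :
  1 - 3 ^- k <= x -> E x -> exists2 y, E y & x = fword (nseq k 2) y.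
Proof.
have [l0 l1] := andP hlambda.
elim: k x => [|k ih] x; first by move=> _ Ex; exists x.
rewrite pow3VS => kx /attractor_preim[y Ey].
have p1 := pow3V_le1 R k.
have y01 := attractor_bound Ey.
(* Here x >= 2/3 > (1+lambda)/3, so only the digit 2 can come first. *)
rewrite /fmapd => -[xE|xE|xE]; try lra.
have [||z Ez yE] := ih y; try by [lra | exact: Ey].
by exists z => //; rewrite /= -yE xE.
Qed.

(** As long as x <= 1/9 < lambda/3, the first digit must be 0. The expansion stops at y <= 1/3,
    where f_0(I) and f_lambda(I) may overlap. *)
Lemma attractor_bottom k x : 3^-1 < lambda ->
  x <= 3 ^- k.+1 -> E x ->
  exists2 y, E y /\ y <= 3^-1 & x = fword (nseq k 0) y.
Proof.
move=> l3; have [l0 l1] := andP hlambda.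
elim: k x => [|k ih] x; first by rewrite expr1 => xk Ex; exists x.
rewrite pow3VS => kx /attractor_preim[y Ey].
have p1 := pow3V_le1 R k.
have p2 := pow3VS R k.
have y01 := attractor_bound Ey.
rewrite /fmapd => -[xE|xE|xE]; try lra.
have [||z Ez yE] := ih y; try by [lra | exact: Ey].
by exists z => //; rewrite /= -yE xE.
Qed.

Lemma attractor_mul3 m x : lambda = 1 - 3 ^- m.+1 ->
  E x -> x <= 3^-1 -> E (3 * x).
Proof.
move=> lE Ex x3.
have [l0 l1] := andP hlambda.
have p0 := pow3V_gt0 R m.
have p1 := pow3V_le1 R m.
have l3 : 3^-1 < lambda by rewrite lE pow3VS; lra.
apply: (closed_pow3V attractor_closed) => n.
elim: n x Ex x3 => [|n ih] x Ex x3.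
  (* At n = 0 any point of E will do, since 3x is in [0, 1]. *)
  exists 0; first exact: attractor0.
  have := attractor_bound Ex.
  by rewrite expr0 invr1 subr0 => x01; rewrite ger0_norm; lra.
have [y Ey [xE|xE|xE]] := attractor_preim Ex.
- exists y => //; have -> : 3 * x - y = 0 by rewrite xE /fmapd; lra.
  by rewrite normr0 ltW// pow3V_gt0.
(* From 3x = y + lambda <= 1 follows y <= 1 - lambda. With y = f_0^m(z) one gets 3x = f_2^(m+1)(3z),
   so an approximation v of 3z yields one of 3x with error at least three times smaller. *)
- have ym : y <= 3 ^- m.+1 by move: x3; rewrite xE /fmapd; lra.
  have [z [Ez z3] yE] := attractor_bottom l3 ym Ey.
  have [v Ev zv] := ih z Ez z3.
  exists (fword (nseq m.+1 2) v).
    by apply: attractor_fword Ev; apply: words_nseq; exact: Omega2.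
  have -> : 3 * x - fword (nseq m.+1 2) v = 3 ^- m / 3 * (3 * z - v).
    rewrite fword_nseq2 xE /fmapd yE fword_nseq0 lE pow3VS; lra.
  rewrite normrM ger0_norm; last by rewrite divr_ge0// ltW.
  rewrite (pow3VS _ n) mulrC ler_pM// ?divr_ge0//; lra.
- by have := attractor_bound Ey; move: xE; rewrite /fmapd; lra.
Qed.

Lemma attractor_fmapd_inv m d x : lambda = 1 - 3 ^- m.+1 ->
  Omega lambda d -> 0 <= x <= 1 -> E (fmapd d x) -> E x.
Proof.
move=> lE /OmegaP Od x01 Edx; have [l0 l1] := andP hlambda.
have l3 : 3^-1 < lambda.
  by have p1 := pow3V_le1 R m; rewrite lE pow3VS; lra.
case: Od => dE; rewrite dE in Edx.
- have <- : 3 * fmapd 0 x = x by rewrite /fmapd; lra.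
  by apply: (attractor_mul3 lE) => //; rewrite /fmapd; lra.
- have [y Ey] := attractor_preim Edx.
  have y01 := attractor_bound Ey.
  case=> xE; last by move: xE; rewrite /fmapd; lra.
    (* In the overlap of f_0(I) and f_lambda(I), y >= lambda = 1 - 3^-(m+1), so y = f_2^(m+1)(z);
       replacing these digits 2 by 0 subtracts exactly lambda and gives x. *)
    have xy : y = x + lambda by move: xE; rewrite /fmapd; lra.
    have [|z Ez yE] := @attractor_top m.+1 y _ Ey; first lra.
    have -> : x = fword (nseq m.+1 0) z.
      by move: yE; rewrite xy fword_nseq2 fword_nseq0 lE; lra.
    by apply: attractor_fword Ez; apply: words_nseq; exact: Omega0.
  by move/fmapd_inj: xE => ->.
- have [y Ey] := attractor_preim Edx.
  have y01 := attractor_bound Ey.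
  case=> xE; try by move: xE; rewrite /fmapd; lra.
  by move/fmapd_inj: xE => ->.
Qed.

Lemma fword_bound w x : words lambda w -> 0 <= x <= 1 -> 0 <= fword w x <= 1.
Proof.
have [l0 l1] := andP hlambda.
move=> + x01; elim: w => [|d w ih] //= /words_cons[/OmegaP Od /ih].
by rewrite /fmapd; case: Od => ->; lra.
Qed.

Lemma lambda_tss m : lambda = 1 - 3 ^- m.+1 -> totally_self_similar lambda E.
Proof.
move=> lE w W; apply/seteqP; split => [_ [x Ex <-]|].
  split; last exact: attractor_fword.
  by exists x => //=; rewrite in_itv /=; exact: attractor_bound.
move=> _ [[x + <-] Ewx]; rewrite /= in_itv /= => x01.
exists x => //; elim: w W Ewx => [|d w ih] //= /words_cons[Od W].
move/(attractor_fmapd_inv lE Od (fword_bound W x01)); exact: ih.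
Qed.

End attractor.

Theorem theorem1 (R : realType) (lambda : R) (E : set R)
    (hlambda : 0 < lambda < 1) (hE : is_attractor lambda E) :
  totally_self_similar lambda E <->
  exists m : nat, (0 < m)%N /\ lambda = 1 - 3 ^- m.
Proof.
split; first exact: tss_lambda.
by move=> [[|m] [// _ lE]]; exact: (lambda_tss hlambda hE lE).
Qed.
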